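(* Let $d=1$, the walk be nearest-neighbor, and assume $\int|\log\pi(0,\pm1)|^{1+\alpha}\,\mathrm{d}\mathbb{P}<\infty$ for some $\alpha>0$. Then there exist $\xi_c,\xi_c'\in\mathbb{R}$ with $-1<\xi_c'\le0\le\xi_c<1$ such that for every $\xi\in(-1,\xi_c')\cup(\xi_c,1)$ there exists $\mu_\xi\in A_\xi\cap M_{1,s}^{\ll}(\Omega\times U)$ with $\mathrm{d}\mu_\xi(\omega,z)=\mathrm{d}(\mu_\xi)^1(\omega)\,\pi(0,z)\,\mathrm{e}^{\theta z+F(\omega,z)+r}$ for some $\theta\in\mathbb{R}$, $F\in\mathcal{K}$ and $r\in\mathbb{R}$.
   Context: Setting: $d=1$, $U=\{-1,1\}$. An environment is $\omega=(\omega_x)_{x\in\mathbb{Z}}$ with $\omega_x=(\pi(x,x+1),\pi(x,x-1))$ a probability vector; $\Omega$ is the space of environments (product topology, Borel $\sigma$-algebra), $(T_z\omega)_x=\omega_{x+z}$, and $\mathbb{P}$ is a probability measure on $\Omega$ stationary and ergodic under the shifts. For $\mu\in M_1(\Omega\times U)$, $\mathrm{d}(\mu)^1(\omega):=\sum_{z\in U}\mathrm{d}\mu(\omega,z)$, $\mathrm{d}(\mu)^2(\omega):=\sum_{z\in U}\mathrm{d}\mu(T_{-z}\omega,z)$; $M_{1,s}^{\ll}(\Omega\times U)$ is the set of $\mu$ with $(\mu)^1=(\mu)^2\ll\mathbb{P}$ and $\frac{\mathrm{d}\mu(\cdot,z)}{\mathrm{d}(\mu)^1}>0$ $\mathbb{P}$-a.s.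 for $z=\pm1$. $A_\xi:=\{\mu\in M_1(\Omega\times U):\int\sum_{z}z\,\mathrm{d}\mu(\omega,z)=\xi\}$. The class $\mathcal{K}$ consists of measurable $F:\Omega\times U\to\mathbb{R}$ with $F(\cdot,z)\in L^{1+\alpha}(\mathbb{P})$ for some $\alpha>0$, $\mathbb{E}[F(\cdot,z)]=0$ for each $z$, and, for $\mathbb{P}$-a.e. $\omega$ and every sequence $(x_k)_{k=0}^n$ in $\mathbb{Z}$ with $x_0=x_n$ and $x_{k+1}-x_k\in U$, $\sum_{k=0}^{n-1}F(T_{x_k}\omega,x_{k+1}-x_k)=0$. *)

(* Defs.v *)
From HB Require Import structures.
From mathcomp Require Import all_boot all_order all_algebra.
From mathcomp Require Import all_classical all_reals all_analysis.
Set Implicit Arguments. Unset Strict Implicit. Unset Printing Implicit Defensive.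
Import Order.TTheory GRing.Theory Num.Theory.
Local Open Scope classical_set_scope.
Local Open Scope ring_scope.

(* d = 1, U = {-1,1}.  An environment omega is encoded by x |-> pi(x,x+1);
   pi(x,x-1) = 1 - pi(x,x+1) (omega_x is a probability vector on U; the
   constraint 0 <= pi(x,x+1) <= 1 is imposed P-a.s. in the theorem). *)

Definition envT (R : realType) := (int -> R)%type.
HB.instance Definition _ (R : realType) := Choice.on (envT R).
(* the point is irrelevant; it is only needed by g_sigma_algebraType *)
HB.instance Definition _ (R : realType) := isPointed.Build (envT R) (fun _ => 0%R).

Definition coord_sets (R : realType) : set (set (envT R)) :=
  [set A | exists (x : int) (B : set R), measurable B /\
           A = (fun w : envT R => w x) @^-1` B].

(* Omega with its (product = Borel of the product topology) sigma-algebra *)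
Definition Env (R : realType) := g_sigma_algebraType (@coord_sets R).

(* U = {-1,1} encoded by bool: true = +1, false = -1 (discrete sigma-algebra) *)
Definition zval (R : realType) (b : bool) : R := if b then 1 else -1.
Definition zint (b : bool) : int := if b then 1%Z else (-1)%Z.

Definition pi0 (R : realType) (w : Env R) (b : bool) : R :=
  if b then w 0%Z else 1 - w 0%Z.

Definition shift (R : realType) (z : int) (w : Env R) : Env R :=
  fun x => w (x + z)%R.

Definition stationary (R : realType) (P : probability (Env R) R) : Prop :=
  forall (z : int) (A : set (Env R)), measurable A ->
    P (shift z @^-1` A) = P A.

Definition ergodic (R : realType) (P : probability (Env R) R) : Prop :=
  forall A : set (Env R), measurable A ->
    (forall z : int, shift z @^-1` A = A) -> P A = 0%E \/ P A = 1%E.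

Definition marg1 (R : realType) (mu : probability (Env R * bool)%type R)
  (A : set (Env R)) : \bar R := mu (A `*` setT).

(* d(mu)^2(w) = sum_z dmu(T_{-z} w, z), i.e. (mu)^2(A) = mu{(w,z) | T_z w in A} *)
Definition marg2 (R : realType) (mu : probability (Env R * bool)%type R)
  (A : set (Env R)) : \bar R := mu [set p | A (shift (zint p.2) p.1)].

Definition int_marg1 (R : realType) (mu : probability (Env R * bool)%type R)
  (A : set (Env R)) (g : Env R -> R) : \bar R :=
  (\int[mu]_(p in A `*` setT) (g p.1)%:E)%E.

Definition M1s_ll (R : realType) (P : probability (Env R) R)
  (mu : probability (Env R * bool)%type R) : Prop :=
  [/\ (forall A, measurable A -> marg1 mu A = marg2 mu A),
      (forall A, measurable A -> P A = 0%E -> marg1 mu A = 0%E) &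
      (forall z : bool, exists g : Env R -> R,
         [/\ measurable_fun setT g, (forall w, 0 <= g w),
             (forall A, measurable A -> mu (A `*` [set z]) = int_marg1 mu A g) &
             {ae P, forall w, 0 < g w}])].

Definition A_xi (R : realType) (xi : R)
  (mu : probability (Env R * bool)%type R) : Prop :=
  (\int[mu]_p (zval R p.2)%:E)%E = xi%:E.

Definition in_K (R : realType) (P : probability (Env R) R)
  (F : Env R * bool -> R) : Prop :=
  [/\ measurable_fun setT F,
      (exists alpha : R, 0 < alpha /\ forall z : bool,
         (\int[P]_w ((`|F (w, z)| `^ (1 + alpha))%:E) < +oo)%E),
      (forall z : bool, (\int[P]_w (F (w, z))%:E)%E = 0%E) &
      {ae P, forall w, forall (n : nat) (x : nat -> int), x 0%N = x n ->
         (forall k, (k < n)%N -> (x k.+1 - x k = 1 \/ x k.+1 - x k = -1)%R) ->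
         \sum_(k < n) F (shift (x k) w, (x k.+1 - x k == 1)%R) = 0}].

Definition density_form (R : realType) (mu : probability (Env R * bool)%type R)
  (theta : R) (F : Env R * bool -> R) (r : R) : Prop :=
  forall (z : bool) (A : set (Env R)), measurable A ->
    mu (A `*` [set z]) =
    int_marg1 mu A (fun w => pi0 w z * expR (theta * zval R z + F (w, z) + r)).

(* Main.v *)
Require Import Defs.
From HB Require Import structures.
From mathcomp Require Import all_boot all_order all_algebra.
From mathcomp Require Import all_classical all_reals all_analysis.
From mathcomp Require Import ring lra zify measurable_realfun.
Import Order.TTheory GRing.Theory Num.Theory.
Import numFieldNormedType.Exports.
Local Open Scope classical_set_scope.
Local Open Scope ring_scope.
Set Implicit Arguments. Unset Strict Implicit. Unset Printing Implicit Defensive.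

(* Fix a direction e and s = e^r in ]0, 1/4].  Write p for the probability of the
   step e.  Tilting the walk by a positive function u that is (1/s)-harmonic, with
   u(x + e) / u(x) = e^{L(T_x w)}, gives a Markov kernel.  Its probability b of a
   step against e solves
     b = s^2 (1 - p) (p o T_{-e}) / (1 - b o T_{-e}),   L = ln (1 - b) - ln s - ln p,
   and F is the gradient field defined by L - E L, with theta = e E L.  For s <= 1/4
   the equation for b is a contraction with b <= 1/4 whatever the environment, so
   no ellipticity is needed.  A stationary density h of the tilted environment
   process has constant flux along the line; with unit flux,
     (1 - b) h = 1 + (b h) o T_e,
   again a contraction, and the invariant probability h / E h has speed e / E h.
   Now E h is Lipschitz in s, equals 1 at s = 0 and exceeds 1 at s = 1/4, so every
   speed strictly between 1 / E h_{1/4} and 1 in the direction e is attained. *)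

(* [all_analysis] also exports a topological [shift]. *)
Local Notation shift := Defs.shift.

(** * Fixed points of contractions along the orbits of a map *)

Section FixedPoint.
Context {R : realType} {T : Type}.
Implicit Types (tau : T -> T) (Phi Psi : T -> R -> R) (B : R).

(** Besides slope at most 1/2, the second clause demands monotonicity in [y]: the iterates from 0
    then increase and stay below [B], so they converge pointwise and no complete function space is
    needed. *)
Definition contracting B Phi : Prop :=
  (forall w y, 0 <= y <= B -> 0 <= Phi w y <= B) /\
  (forall w x y, 0 <= x -> x <= y -> y <= B ->
     0 <= Phi w y - Phi w x <= (y - x) / 2).

Definition fix_iter tau Phi (n : nat) : T -> R :=
  iter n (fun u w => Phi w (u (tau w))) (fun=> 0).

Definition fixpt tau Phi (w : T) : R := limn (fun n => fix_iter tau Phi n w).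

Section Contracting.
Variables (tau : T -> T) (Phi : T -> R -> R) (B : R).
Hypotheses (B0 : 0 <= B) (PhiB : contracting B Phi).

Lemma fix_iterS n w :
  fix_iter tau Phi n.+1 w = Phi w (fix_iter tau Phi n (tau w)).
Proof. by []. Qed.

Lemma fix_iter_itv n w : 0 <= fix_iter tau Phi n w <= B.
Proof.
elim: n w => [w|n IH w]; first by rewrite /= lexx.
by rewrite fix_iterS; apply: PhiB.1.
Qed.

Lemma fix_iter_nondecreasing w :
  nondecreasing_seq (fun n => fix_iter tau Phi n w).
Proof.
apply/nondecreasing_seqP => n; elim: n w => [w|n IH w].
  by have /andP[] := fix_iter_itv 1 w.
rewrite 2!fix_iterS -subr_ge0.
have /andP[u0 _] := fix_iter_itv n (tau w).
have /andP[_ uB] := fix_iter_itv n.+1 (tau w).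
by have /andP[] := PhiB.2 w _ _ u0 (IH (tau w)) uB.
Qed.

Lemma fixpt_cvg w : fix_iter tau Phi n w @[n --> \oo] --> fixpt tau Phi w.
Proof.
apply: nondecreasing_is_cvgn; first exact: fix_iter_nondecreasing.
by exists B => _ [n _ <-]; have /andP[] := fix_iter_itv n w.
Qed.

Lemma fixpt_itv w : 0 <= fixpt tau Phi w <= B.
Proof.
apply/andP; split.
  apply: limr_ge; first by apply/cvg_ex; eexists; exact: fixpt_cvg.
  by apply: nearW => n; have /andP[] := fix_iter_itv n w.
apply: limr_le; first by apply/cvg_ex; eexists; exact: fixpt_cvg.
by apply: nearW => n; have /andP[] := fix_iter_itv n w.
Qed.

Lemma contracting_norm w x y : 0 <= x <= B -> 0 <= y <= B ->
  `|Phi w x - Phi w y| <= `|x - y| / 2.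
Proof.
wlog xy : x y / y <= x.
  move=> H xB yB; have [xy|/ltW xy] := leP y x; first exact: H.
  by rewrite distrC (distrC x); apply: H.
move=> /andP[_ xB] /andP[y0 _].
have /andP[h1 h2] := PhiB.2 w _ _ y0 xy xB.
by rewrite ger0_norm// ger0_norm// subr_ge0.
Qed.

(** Limit of the recursion for the iterates; the Lipschitz bound supplies the continuity of
    [Phi w]. *)
Lemma fixptE w : fixpt tau Phi w = Phi w (fixpt tau Phi (tau w)).
Proof.
have h1 : fix_iter tau Phi n.+1 w @[n --> \oo] --> fixpt tau Phi w.
  by have := @fixpt_cvg w; rewrite -cvg_shiftS.
apply: (cvg_unique _ h1) => //.
apply/cvgrPdist_le => e e0; near=> n.
rewrite fix_iterS (le_trans (contracting_norm _ _ _)) ?fix_iter_itv ?fixpt_itv//.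
rewrite (le_trans (_ : _ <= `|fixpt tau Phi (tau w) - fix_iter tau Phi n (tau w)|))//.
  by rewrite ler_pdivrMr// ler_peMr// ler1n.
near: n; move: e e0; apply/cvgrPdist_le; exact: fixpt_cvg.
Unshelve. all: by end_near. Qed.

End Contracting.

(** Induction on the iterates: one step halves the old distance and adds at most [delta], and
    [2 * delta] is the bound that this recursion preserves. *)
Lemma fixpt_dist tau Phi Psi B (delta : R) : 0 <= B -> 0 <= delta ->
  contracting B Phi -> contracting B Psi ->
  (forall w y, 0 <= y <= B -> `|Phi w y - Psi w y| <= delta) ->
  forall w, `|fixpt tau Phi w - fixpt tau Psi w| <= 2 * delta.
Proof.
move=> B0 d0 PhiB PsiB PhiPsi.
have dist_iter n w : `|fix_iter tau Phi n w - fix_iter tau Psi n w| <= 2 * delta.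
  elim: n w => [w|n IH w]; first by rewrite subrr normr0 mulr_ge0.
  rewrite !fix_iterS (le_trans (ler_distD (Phi w (fix_iter tau Psi n (tau w))) _ _))//.
  have h1 : `|Phi w (fix_iter tau Phi n (tau w)) -
              Phi w (fix_iter tau Psi n (tau w))| <=
      `|fix_iter tau Phi n (tau w) - fix_iter tau Psi n (tau w)| / 2.
    by apply: (contracting_norm PhiB); exact: fix_iter_itv.
  have h2 := PhiPsi w _ (fix_iter_itv tau B0 PsiB n (tau w)).
  have h3 := IH (tau w); lra.
move=> w; have cvg_dist : `|fix_iter tau Phi n w - fix_iter tau Psi n w| @[n --> \oo]
    --> `|fixpt tau Phi w - fixpt tau Psi w|.
  apply: cvg_norm; apply: cvgB; first exact: (@fixpt_cvg tau Phi B B0 PhiB w).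
  exact: (@fixpt_cvg tau Psi B B0 PsiB w).
rewrite -(cvg_lim _ cvg_dist)//; apply: limr_le; first by apply/cvg_ex; eexists; exact: cvg_dist.
by apply: nearW => n; exact: dist_iter.
Qed.

End FixedPoint.

(** The iterates are measurable and converge pointwise. Preservation of measurability is asked only
    for [u] with values in [0, B], where the denominators met later stay positive. *)
Lemma measurable_fixpt {R : realType} d (T : measurableType d) (tau : T -> T)
    (Phi : T -> R -> R) (B : R) : 0 <= B -> contracting B Phi ->
  (forall u : T -> R, measurable_fun setT u -> (forall w, 0 <= u w <= B) ->
    measurable_fun setT (fun w => Phi w (u (tau w)))) ->
  measurable_fun setT (fixpt tau Phi).
Proof.
move=> B0 PhiB mPhi; apply: (@measurable_fun_cvg _ _ _ _ (fix_iter tau Phi)).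
  elim=> [|n IH]; first exact: measurable_cst.
  by apply: mPhi => // w; exact: fix_iter_itv.
by move=> w _; exact: (@fixpt_cvg _ _ tau Phi B B0 PhiB w).
Qed.

(** * Measures given by densities *)

Section Density.
Context d (T : measurableType d) (R : realType) (P : probability T R).
Local Open Scope ereal_scope.

(** Integrating [g] over sets gives a finite measure dominated by [P]. Its Radon-Nikodym derivative
    is a.e. [g], and change of variables extends the formula from sets to nonnegative functions. *)
Lemma density_measure (g : T -> R) : (forall x, (0 <= g x)%R) ->
  P.-integrable setT (EFin \o g) ->
  exists nu : {measure set T -> \bar R},
    forall D (f : T -> \bar R), measurable D -> measurable_fun D f ->
      (forall x, 0 <= f x) ->
      \int[nu]_(x in D) f x = \int[P]_(x in D) (f x * (g x)%:E).
Proof.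
move=> g0 ig.
have mg : measurable_fun setT (EFin \o g) by exact: measurable_int ig.
pose nu0 (A : set T) := \int[P]_(x in A) (g x)%:E.
have nu00 : nu0 set0 = 0 by rewrite /nu0 integral_set0.
have nu0_ge0 A : 0 <= nu0 A by apply: integral_ge0 => x _; rewrite lee_fin.
have nu0_sadd : semi_sigma_additive nu0.
  move=> A mA tA mUA; rewrite /nu0 ge0_integral_bigcup//; last 2 first.
    exact: measurable_funTS.
    by move=> x _; rewrite lee_fin.
  apply: is_cvg_ereal_nneg_natsum_cond => n _ _.
  by apply: integral_ge0 => x _; rewrite lee_fin.
pose nuM := isMeasure.Build _ _ _ nu0 nu00 nu0_ge0 nu0_sadd.
pose nu1 : {measure set T -> \bar R} := HB.pack nu0 nuM.
have nufin : fin_num_fun nu1.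
  move=> A mA; rewrite ge0_fin_numE ?measure_ge0//.
  have /integrableP[_] := integrableS measurableT mA (@subsetT _ A) ig.
  by under eq_integral do rewrite /= ger0_norm//.
pose nuF := Measure_isFinite.Build _ _ _ nu1 nufin.
pose nu : {finite_measure set T -> \bar R} := HB.pack nu0 nuM nuF.
exists nu => D f mD mf f0.
have nuP : nu `<< P.
  apply/null_content_dominatesP => A mA PA.
  apply: null_set_integral => //.
  exact: measurable_funTS.
rewrite -(Radon_Nikodym_SigmaFinite.change_of_variables nuP)//.
(* Both functions have the same integral over every measurable set. *)
have h : ae_eq P setT (Radon_Nikodym_SigmaFinite.f nu P) (EFin \o g).
  apply: integral_ae_eq => //.
    exact: Radon_Nikodym_SigmaFinite.f_integrable.
  by move=> E _ mE; rewrite -Radon_Nikodym_SigmaFinite.f_integral.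
apply: ae_eq_integral => //.
- apply: emeasurable_funM => //; apply: measurable_funTS.
  exact: measurable_int (Radon_Nikodym_SigmaFinite.f_integrable nuP).
- by apply: emeasurable_funM => //; exact: measurable_funTS.
- apply: ae_eqe_mul2l; exact: ae_eq_subset h.
Qed.

(** [mu] is the sum of the images of the measures with densities [g true] and [g false] under the
    inclusions of [T] as the two sheets of [T * bool]. *)
Lemma density_prod_bool (g : bool -> T -> R) :
  (forall z x, (0 <= g z x)%R) ->
  (forall z, P.-integrable setT (EFin \o g z)) ->
  \int[P]_x (g true x)%:E + \int[P]_x (g false x)%:E = 1 ->
  exists mu : probability (T * bool)%type R,
    forall D (f : T * bool -> \bar R), measurable D -> measurable_fun setT f ->
      (forall x, 0 <= f x) ->
      \int[mu]_(x in D) f x =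
      \int[P]_(x in [set x | D (x, true)]) (f (x, true) * (g true x)%:E) +
      \int[P]_(x in [set x | D (x, false)]) (f (x, false) * (g false x)%:E).
Proof.
move=> g0 ig g1.
have [nu1 nu1E] := density_measure (g0 true) (ig true).
have [nu2 nu2E] := density_measure (g0 false) (ig false).
pose i1 (x : T) : T * bool := (x, true); pose i2 (x : T) : T * bool := (x, false).
have mi1 : measurable_fun setT i1 by exact: pair2_measurable.
have mi2 : measurable_fun setT i2 by exact: pair2_measurable.
pose m1 : {measure set (T * bool)%type -> \bar R} :=
  measure_function_pushforward__canonical__measure_function_Measure nu1 mi1.
pose m2 : {measure set (T * bool)%type -> \bar R} :=
  measure_function_pushforward__canonical__measure_function_Measure nu2 mi2.
pose m := measure_add m1 m2.
have mE D (f : T * bool -> \bar R) : measurable D -> measurable_fun setT f ->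
      (forall x, 0 <= f x) ->
      \int[m]_(x in D) f x =
      \int[P]_(x in [set x | D (x, true)]) (f (x, true) * (g true x)%:E) +
      \int[P]_(x in [set x | D (x, false)]) (f (x, false) * (g false x)%:E).
  move=> mD mf f0.
  have mfD : measurable_fun D f by exact: measurable_funTS.
  rewrite ge0_integral_measure_add//.
  rewrite (ge0_integral_pushforward mi1)// (ge0_integral_pushforward mi2)//.
  have mD1 : measurable (i1 @^-1` D) by rewrite -[X in measurable X]setTI; exact: (mi1 measurableT).
  have mD2 : measurable (i2 @^-1` D) by rewrite -[X in measurable X]setTI; exact: (mi2 measurableT).
  have mf1 : measurable_fun (i1 @^-1` D) (f \o i1).
    by apply: measurable_funTS; exact: measurableT_comp.
  have mf2 : measurable_fun (i2 @^-1` D) (f \o i2).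
    by apply: measurable_funTS; exact: measurableT_comp.
  have f01 x : 0 <= (f \o i1) x by exact: f0.
  have f02 x : 0 <= (f \o i2) x by exact: f0.
  by rewrite (nu1E _ _ mD1 mf1 f01) (nu2E _ _ mD2 mf2 f02).
have m1E : m setT = 1.
  have := mE setT (cst 1) measurableT (measurable_cst _) (fun=> lee01).
  rewrite integral_cst// mul1e => mT; apply: (etrans mT); apply: etrans g1.
  by congr (_ + _); apply: eq_integral => x _; exact: mul1e.
pose mu0 : set (T * bool)%type -> \bar R := m.
pose muM := isMeasure.Build _ _ _ mu0 (measure0 m) (measure_ge0 m)
  (@measure_semi_sigma_additive _ _ _ m).
pose mu1 : {measure set (T * bool)%type -> \bar R} := HB.pack mu0 muM.
pose muP := Measure_isProbability.Build _ _ _ mu1 m1E.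
pose mu : probability (T * bool)%type R := HB.pack mu0 muM muP.
exists mu => D f mD mf f0; rewrite -mE//.
Qed.
End Density.

(** * Shifts of the environment *)

Section Shift.
Context {R : realType}.

Lemma measurable_coord (x : int) : measurable_fun setT (fun w : Env R => w x).
Proof.
move=> _ B mB; rewrite setTI; apply: sub_sigma_algebra.
by exists x, B.
Qed.

Lemma measurable_shift (z : int) : measurable_fun setT (@shift R z).
Proof.
apply: (@measurability _ _ (Env R) (Env R) setT _ (@coord_sets R)) => //.
move=> _ [_ [x [B [mB ->]] <-]]; rewrite setTI.
have -> : shift z @^-1` ((fun w : envT R => w x) @^-1` B) =
   (fun w : Env R => w (x + z)) @^-1` B by [].
rewrite -[X in measurable X]setTI; exact: measurable_coord.
Qed.

Lemma shift_shift (y z : int) (w : Env R) : shift y (shift z w) = shift (y + z) w.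
Proof. by apply/funext => x; rewrite /shift addrA. Qed.

Lemma shift0 (w : Env R) : shift 0 w = w.
Proof. by apply/funext => x; rewrite /shift addr0. Qed.

Lemma shiftK (z : int) (w : Env R) : shift z (shift (- z) w) = w.
Proof. by rewrite shift_shift subrr shift0. Qed.

Lemma shiftNK (z : int) (w : Env R) : shift (- z) (shift z w) = w.
Proof. by rewrite shift_shift addNr shift0. Qed.

Lemma zintN (e : bool) : zint (~~ e) = - zint e.
Proof. by case: e. Qed.

Lemma measurable_inv_pos d (T : measurableType d) (f : T -> R) :
  (forall x, 0 < f x) -> measurable_fun setT f ->
  measurable_fun setT (fun x => (f x)^-1).
Proof.
move=> f0 mf.
have -> : (fun x => (f x)^-1) = (fun x => f x `^ (-1)).
  by apply/funext => x; rewrite powR_inv1// ltW.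
exact: (measurableT_comp (@measurable_powR R (-1)) mf).
Qed.

End Shift.

(** * The tilted walk and its unit-flux density *)

Section Walk.
Context {R : realType}.
(* the direction in which the tilted walk drifts *)
Variable e : bool.
Implicit Types (w : Env R) (s : R).

(* Clamping makes all pointwise estimates hold for every environment, not only
   for almost every one. *)
Definition clamp01 (x : R) : R := Num.max 0 (Num.min 1 x).

Definition jump w : R := if e then clamp01 (w 0) else 1 - clamp01 (w 0).

(** Up to clamping, the probability that the untilted walk steps against [e] and then straight
    back. *)
Definition cond w : R := (1 - jump w) * jump (shift (- zint e) w).

(* [back s w] is the probability that the tilted walk steps against [e]. *)
Definition back_map s w y : R := s ^+ 2 * cond w / (1 - y).
Definition back s : Env R -> R := fixpt (shift (- zint e)) (back_map s).

(* [inv_dens s] is the invariant density normalised to have unit flux in the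
   direction [e]; see [inv_densE]. *)
Definition inv_map s w y : R :=
  (1 + back s (shift (zint e) w) * y) / (1 - back s w).
Definition inv_dens s : Env R -> R := fixpt (shift (zint e)) (inv_map s).

Lemma clamp01_itv x : 0 <= clamp01 x <= 1.
Proof. by rewrite /clamp01 le_max lexx/= ge_max ler01 ge_min lexx. Qed.

Lemma clamp01_id x : 0 <= x <= 1 -> clamp01 x = x.
Proof. by move=> /andP[x0 x1]; rewrite /clamp01 (min_idPr x1) (max_idPr x0). Qed.

Lemma jump_itv w : 0 <= jump w <= 1.
Proof. by rewrite /jump; have := clamp01_itv (w 0); case: e; lra. Qed.

Lemma cond_itv w : 0 <= cond w <= 1.
Proof.
have /andP[j0 j1] := jump_itv w; have /andP[k0 k1] := jump_itv (shift (- zint e) w).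
by rewrite /cond mulr_ge0//= ?subr_ge0// mulr_ile1// ?subr_ge0//; lra.
Qed.

Lemma measurable_jump : measurable_fun setT jump.
Proof.
have mc : measurable_fun setT (fun w : Env R => clamp01 (w 0)).
  apply: (measurable_maxr (measurable_cst _)).
  apply: (measurable_minr (measurable_cst _)).
  exact: measurable_coord.
by rewrite /jump; case: e => //; apply: measurable_funB.
Qed.

Lemma measurable_cond : measurable_fun setT cond.
Proof.
apply: measurable_funM; first by apply: measurable_funB => //; exact: measurable_jump.
by apply: measurableT_comp; [exact: measurable_jump|exact: measurable_shift].
Qed.

(** The numerator is at most 1/16 and 1 - y at least 3/4, so the values are at most 1/12 and the
    slopes at most 1/9. *)
Lemma back_contracting s : 0 <= s <= 4^-1 -> contracting 4^-1 (back_map s).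
Proof.
move=> s_itv; split=> [w y y_itv|w x y x0 xy y1].
  have := cond_itv w; rewrite /back_map; set c := cond w => c_itv.
  have s2 : 0 <= s ^+ 2 * c <= 16^-1 by nra.
  rewrite divr_ge0/= ?ler_pdivrMr; lra.
have := cond_itv w; rewrite /back_map; set c := cond w => c_itv.
have s2 : 0 <= s ^+ 2 * c <= 16^-1 by nra.
have -> : s ^+ 2 * c / (1 - y) - s ^+ 2 * c / (1 - x) =
   (s ^+ 2 * c * (y - x)) / ((1 - x) * (1 - y)) by field; lra.
have xy1 : 2^-1 <= (1 - x) * (1 - y) by nra.
rewrite divr_ge0/= ?ler_pdivrMr; nra.
Qed.

Lemma back_itv s w : 0 <= s <= 4^-1 -> 0 <= back s w <= 4^-1.
Proof. by move=> sI; apply: fixpt_itv (back_contracting sI) _; lra. Qed.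

Lemma backE s w : 0 <= s <= 4^-1 ->
  back s w = s ^+ 2 * cond w / (1 - back s (shift (- zint e) w)).
Proof. by move=> sI; apply: (fixptE _ _ (back_contracting sI)); lra. Qed.

Lemma measurable_back s : 0 <= s <= 4^-1 -> measurable_fun setT (back s).
Proof.
move=> sI; apply: measurable_fixpt (back_contracting sI) _; first lra.
move=> u mu uB; apply: measurable_funM.
  by apply: measurable_funM => //; exact: measurable_cond.
apply: measurable_inv_pos => [w|]; first by have := uB (shift (- zint e) w); lra.
apply: measurable_funB => //; apply: measurableT_comp => //.
exact: measurable_shift.
Qed.

(** At fixed [y] the two maps differ by at most |s - t| (s + t) / (1 - y), hence by at most |s - t|;
    [fixpt_dist] doubles this. *)
Lemma back_lipschitz s t w : 0 <= s <= 4^-1 -> 0 <= t <= 4^-1 ->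
  `|back s w - back t w| <= 2 * `|s - t|.
Proof.
move=> sI tI; apply: (@fixpt_dist _ _ _ _ _ 4^-1) => //.
- exact: back_contracting.
- exact: back_contracting.
move=> v y yI; rewrite /back_map -mulrBl -mulrBl.
have := cond_itv v; move: (cond v) => c cI.
have -> : s ^+ 2 - t ^+ 2 = (s - t) * (s + t) by ring.
rewrite !normrM -!mulrA ler_piMr//.
rewrite (ger0_norm (x := s + t)); last lra.
rewrite (ger0_norm (x := c)); last lra.
rewrite (ger0_norm (x := (1 - y)^-1)); last by rewrite invr_ge0; lra.
rewrite mulrA ler_pdivrMr; nra.
Qed.

Lemma back0 w : back 0 w = 0.
Proof. by rewrite backE ?expr0n/= ?mul0r//; lra. Qed.

(** As [back] is at most 1/4, the values are at most (1 + 2/4) / (3/4) = 2, so the bound 2 just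
    reproduces itself, and the slope is at most 1/3. *)
Lemma inv_contracting s : 0 <= s <= 4^-1 -> contracting 2 (inv_map s).
Proof.
move=> sI; split=> [w y yI|w x y x0 xy y1].
  rewrite /inv_map; have := back_itv w sI; have := back_itv (shift (zint e) w) sI.
  set b1 := back _ _ => b1I; set b := back _ _ => bI.
  rewrite divr_ge0/= ?ler_pdivrMr; nra.
rewrite /inv_map; have := back_itv w sI; have := back_itv (shift (zint e) w) sI.
set b1 := back _ _ => b1I; set b := back _ _ => bI.
have -> : (1 + b1 * y) / (1 - b) - (1 + b1 * x) / (1 - b) = (b1 * (y - x)) / (1 - b).
  by field; lra.
rewrite divr_ge0/= ?ler_pdivrMr; nra.
Qed.

Lemma inv_dens_itv s w : 0 <= s <= 4^-1 -> 0 <= inv_dens s w <= 2.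
Proof. by move=> sI; apply: fixpt_itv (inv_contracting sI) _; lra. Qed.

(** Flux balance on the bond from the origin to its neighbour in direction [e]: the mass crossing
    along [e] exceeds the mass crossing back by exactly 1. *)
Lemma inv_densE s w : 0 <= s <= 4^-1 ->
  (1 - back s w) * inv_dens s w =
  1 + back s (shift (zint e) w) * inv_dens s (shift (zint e) w).
Proof.
move=> sI; rewrite {1}/inv_dens (fixptE _ _ (inv_contracting sI)) ?/inv_map; last lra.
have bI := back_itv w sI; rewrite -/(inv_dens _) mulrC divfK//; lra.
Qed.

(** The flux equation gives (1 - b) h >= 1, and 1 / (1 - b) >= 1 + b. *)
Lemma inv_dens_ge s w : 0 <= s <= 4^-1 -> 1 + back s w <= inv_dens s w.
Proof.
move=> sI; have := inv_densE w sI; have := inv_dens_itv (shift (zint e) w) sI.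
have := back_itv w sI; have := back_itv (shift (zint e) w) sI.
have := inv_dens_itv w sI.
set b := back _ _; set b1 := back _ _; set h := inv_dens _ _; set h1 := inv_dens _ _.
nra.
Qed.

Lemma measurable_inv_dens s : 0 <= s <= 4^-1 -> measurable_fun setT (inv_dens s).
Proof.
move=> sI; apply: measurable_fixpt (inv_contracting sI) _; first lra.
have mb := measurable_back sI.
move=> u mu uB; apply: measurable_funM.
  apply: measurable_funD => //; apply: measurable_funM; apply: measurableT_comp => //;
    exact: measurable_shift.
apply: measurable_inv_pos => [w|]; first by have := back_itv w sI; lra.
exact: measurable_funB.
Qed.

Lemma inv_dens_lipschitz s t w : 0 <= s <= 4^-1 -> 0 <= t <= 4^-1 ->
  `|inv_dens s w - inv_dens t w| <= 32 * `|s - t|.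
Proof.
(* [fixpt_dist] accounts for the 2. The 16 bounds the change of [inv_map]: a numerator of at most 8
   |s - t| over a denominator of at least 1/2. *)
move=> sI tI; have -> : 32 * `|s - t| = 2 * (16 * `|s - t|) by ring.
apply: (@fixpt_dist _ _ _ _ _ 2) => //.
- exact: inv_contracting.
- exact: inv_contracting.
move=> v y yI; rewrite /inv_map.
have := back_lipschitz v sI tI; have := back_lipschitz (shift (zint e) v) sI tI.
have := back_itv v sI; have := back_itv (shift (zint e) v) sI.
have := back_itv v tI; have := back_itv (shift (zint e) v) tI.
set b1' := back t _; set b' := back t _; set b1 := back s _; set b := back s _.
move=> b1'I b'I b1I bI d1 d.
(* Separates the changes of the two backward probabilities, each controlled by [back_lipschitz]. *)
have -> : (1 + b1 * y) / (1 - b) - (1 + b1' * y) / (1 - b') =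
   ((b1 - b1') * (y * (1 - b')) + (b - b') * (1 + b1' * y)) / ((1 - b) * (1 - b')).
  by field; lra.
have bb : 2^-1 <= (1 - b) * (1 - b') by nra.
set D := `|s - t| in d1 d *; have D0 : 0 <= D by exact: normr_ge0.
rewrite normrM normfV (ger0_norm (x := (1 - b) * _)); last lra.
rewrite ler_pdivrMr; last lra.
rewrite (le_trans (ler_normD _ _))// !normrM.
rewrite (ger0_norm (x := y)); last lra.
rewrite (ger0_norm (x := 1 - b')); last lra.
rewrite (ger0_norm (x := 1 + _)); last nra.
have n1 : `|b1 - b1'| * (y * (1 - b')) <= 2 * D * 2 by rewrite ler_pM//; nra.
have n2 : `|b - b'| * (1 + b1' * y) <= 2 * D * 2 by rewrite ler_pM//; nra.
nra.
Qed.

Lemma inv_dens0 w : inv_dens 0 w = 1.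
Proof. by have := @inv_densE 0 w; rewrite !back0 subr0 mul1r mul0r addr0; apply; lra. Qed.

End Walk.

(** * Lipschitz continuity and integrals of bounded functions *)

Lemma lipschitz_within_continuous {R : realType} (A : set R) (f : R -> R) (K : R) :
  0 < K -> (forall x y, A x -> A y -> `|f x - f y| <= K * `|x - y|) ->
  {within A, continuous f}.
Proof.
move=> K0 fK; apply/subspace_continuousP => x Ax.
apply/cvgrPdist_le => eps eps0; near=> y.
have Ay : A y by near: y; exact: withinT.
rewrite (le_trans (fK _ _ Ax Ay))// mulrC -ler_pdivlMr//.
near: y; apply: cvg_within.
have /cvgrPdist_le/(_ _ (divr_gt0 eps0 K0)) : y @[y --> x] --> x by exact: cvg_id.
exact.
Unshelve. all: by end_near. Qed.

Lemma bounded_integrable d (T : measurableType d) (R : realType)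
    (P : probability T R) (f : T -> R) (C : R) :
  measurable_fun setT f -> (forall x, `|f x| <= C) ->
  P.-integrable setT (EFin \o f).
Proof.
move=> mf fC.
apply: (@le_integrable _ _ _ _ _ measurableT _ (EFin \o cst C)).
- exact/measurable_EFinP.
- move=> x _; by rewrite /= lee_fin (le_trans (fC x))// ler_norm.
- exact: finite_measure_integrable_cst.
Qed.

Lemma Rintegral_prob_cst d (T : measurableType d) (R : realType)
    (P : probability T R) (c : R) : \int[P]_x c = c.
Proof.
rewrite Rintegral_cst//; have /(congr1 fine) /= PT := @probability_setT _ _ _ P.
by apply: (etrans (congr1 (fun x => c * x) PT)); rewrite mulr1.
Qed.

(** * Consequences of stationarity *)

Section Stationary.
Context {R : realType} (P : probability (Env R) R) (Pstat : stationary P).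

(** A stationary [P] is its own image under a shift, so this is the change of variables for
    push-forwards. *)
Lemma stationary_ge0_integral (z : int) (f : Env R -> \bar R) :
  measurable_fun setT f -> (forall w, 0 <= f w)%E ->
  (\int[P]_w f (shift z w) = \int[P]_w f w)%E.
Proof.
move=> mf f0; have mz := @measurable_shift R z.
have := @ge0_integral_pushforward _ _ _ _ R _ mz P setT f measurableT mf (fun w _ => f0 w).
rewrite preimage_setT => <-.
apply: eq_measure_integral => A mA _; exact: Pstat.
Qed.

Lemma stationary_integrable (z : int) (f : Env R -> \bar R) :
  P.-integrable setT f -> P.-integrable setT (fun w => f (shift z w)).
Proof.
move=> /integrableP[mf fy]; have mz := @measurable_shift R z.
apply/integrableP; split; first exact: measurableT_comp.
rewrite (stationary_ge0_integral z (f := fun w => `|f w|%E))//.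
exact: measurableT_comp.
Qed.

Lemma stationary_integral (z : int) (f : Env R -> \bar R) :
  P.-integrable setT f ->
  (\int[P]_w f (shift z w) = \int[P]_w f w)%E.
Proof.
move=> fi; have mz := @measurable_shift R z; have mf := measurable_int _ fi.
have := @integral_pushforward _ _ _ _ R _ mz P setT f mf
  (stationary_integrable z fi) measurableT.
rewrite preimage_setT => <-.
apply: eq_measure_integral => A mA _; exact: Pstat.
Qed.

Lemma stationary_Rintegral (z : int) (f : Env R -> R) :
  P.-integrable setT (EFin \o f) ->
  \int[P]_w f (shift z w) = \int[P]_w f w.
Proof. by move=> fi; rewrite /Rintegral (stationary_integral z fi). Qed.

Lemma stationary_ae (z : int) (Q : Env R -> Prop) :
  {ae P, forall w, Q w} -> {ae P, forall w, Q (shift z w)}.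
Proof.
move=> [N [mN PN NQ]]; exists (shift z @^-1` N); split.
- by rewrite -[X in measurable X]setTI; exact: (@measurable_shift R z).
- by rewrite Pstat.
- by move=> w /= nQ; apply: NQ.
Qed.

End Stationary.

(** * Range of the mean of the unit-flux density *)

Section Mean.
Context {R : realType} (P : probability (Env R) R) (Pstat : stationary P).
Variable e : bool.
Implicit Type s : R.

(** Since the flux is normalised to 1, this total mass is the reciprocal of the speed in direction
    [e]. *)
Definition inv_mass s : R := \int[P]_w inv_dens e s w.

Lemma integrable_inv_dens s : 0 <= s <= 4^-1 ->
  P.-integrable setT (EFin \o inv_dens e s).
Proof.
move=> sI; apply: (@bounded_integrable _ _ _ _ _ 2); first exact: measurable_inv_dens.
by move=> w; have := inv_dens_itv e w sI; rewrite ler_norml; lra.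
Qed.

Lemma inv_mass_lipschitz s t : 0 <= s <= 4^-1 -> 0 <= t <= 4^-1 ->
  `|inv_mass s - inv_mass t| <= 32 * `|s - t|.
Proof.
move=> sI tI.
have is_ := integrable_inv_dens sI; have it_ := integrable_inv_dens tI.
rewrite /inv_mass -RintegralB//.
apply: (le_trans (le_normr_Rintegral measurableT _)).
  exact: (integrableB measurableT is_ it_).
apply: (@le_trans _ _ (\int[P]_w (32 * `|s - t|))).
  apply: le_Rintegral => //.
  - exact: (integrable_norm (integrableB measurableT is_ it_)).
  - exact: finite_measure_integrable_cst.
  - by move=> w _; exact: inv_dens_lipschitz.
by rewrite Rintegral_prob_cst.
Qed.

Lemma inv_mass0 : inv_mass 0 = 1.
Proof.
rewrite /inv_mass (@eq_Rintegral _ _ _ P setT (cst 1)); last by move=> w _; exact: inv_dens0.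
by rewrite Rintegral_prob_cst.
Qed.

Hypothesis jump_gt0 : {ae P, forall w, 0 < jump e w < 1}.

(** The equation for [back] involves the environment at the origin and one step behind it;
    stationarity carries the nondegeneracy to the second site. *)
Lemma back_gt0 s : 0 < s <= 4^-1 -> {ae P, forall w, 0 < back e s w}.
Proof.
move=> sI; have := stationary_ae Pstat (- zint e) jump_gt0; move: jump_gt0.
apply: filterS2 => w j1 j2; rewrite backE; last lra.
have bI : 0 <= back e s (shift (- zint e) w) <= 4^-1 by apply: back_itv; lra.
rewrite divr_gt0//; last lra.
by rewrite mulr_gt0 ?exprn_gt0// ?mulr_gt0//; lra.
Qed.

(** [inv_dens] is at least 1 + [back], and [back] is nonnegative everywhere and positive almost
    surely, so its mean is positive. *)
Lemma inv_mass_gt1 s : 0 < s <= 4^-1 -> 1 < inv_mass s.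
Proof.
move=> sI; have sI' : 0 <= s <= 4^-1 by lra.
have ih := integrable_inv_dens sI'.
have ib : P.-integrable setT (EFin \o back e s).
  apply: (@bounded_integrable _ _ _ _ _ 1); first exact: measurable_back.
  by move=> w; have := back_itv e w sI'; rewrite ler_norml; lra.
have i1 : P.-integrable setT (EFin \o cst 1).
  exact: finite_measure_integrable_cst.
apply: (@lt_le_trans _ _ (\int[P]_w (1 + back e s w))); last first.
  apply: le_Rintegral => //; first exact: (integrableD measurableT i1 ib).
  by move=> w _; exact: inv_dens_ge.
rewrite (@RintegralD _ _ _ P _ (cst 1))// Rintegral_prob_cst.
rewrite ltrDl lt_neqAle; apply/andP; split; last first.
  by apply: Rintegral_ge0 => w _; have := back_itv e w sI'; lra.
apply/negP => /eqP b0.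
have b_ae0 : ae_eq P setT (EFin \o back e s) (cst 0%E).
  apply/(ae_eq_integral_abs P measurableT (measurable_int _ ib)).
  rewrite -[RHS](_ : (\int[P]_w (back e s w)%:E = 0)%E).
    apply: eq_integral => w _; rewrite /= ger0_norm//.
    by have := back_itv e w sI'; lra.
  by rewrite -[LHS]fineK ?(integrable_fin_num measurableT ib)//; congr EFin; exact: esym b0.
(* With integral 0, [back] would vanish almost surely, against [back_gt0]; the whole space would
   then be null. *)
have [N [mN PN subN]] : {ae P, forall w, False}.
  move: (back_gt0 sI) b_ae0; apply: filterS2 => w + /(_ I) [].
  by move=> + bw; rewrite bw ltxx.
have : (P setT <= P N)%E.
  by apply: le_measure; rewrite ?inE// => w _; apply: subN => -[].
by rewrite PN probability_setT lee_fin ler10.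
Qed.

Lemma inv_mass_onto (v : R) : 1 < v < inv_mass 4^-1 ->
  exists2 s, 0 < s <= 4^-1 & inv_mass s = v.
Proof.
move=> vI.
have [|||s] := @IVT R inv_mass 0 4^-1 v.
- lra.
- apply: (@lipschitz_within_continuous _ _ _ 32) => // x y.
  rewrite /= !in_itv/=; exact: inv_mass_lipschitz.
- by rewrite inv_mass0 ge_min le_max; apply/andP; split; apply/orP; [left|right]; lra.
rewrite in_itv/= => sI sv; exists s => //.
(* The value at [s = 0] is 1, which is below [v]. *)
have [s0|s0] := eqVneq s 0; last first.
  by case/andP: sI => sge0 sle; rewrite lt_neqAle eq_sym s0 sge0.
by move: vI; rewrite -sv s0 inv_mass0 ltxx.
Qed.

End Mean.

(** * The stationary law of the tilted environment process *)

Section InvariantMeasure.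
Context {R : realType} (P : probability (Env R) R) (Pstat : stationary P).
Variables (e : bool) (s : R).
Hypothesis s_itv : 0 <= s <= 4^-1.

Definition trans (z : bool) (w : Env R) : R :=
  if z == e then 1 - back e s w else back e s w.

Definition dens (w : Env R) : R := inv_dens e s w / inv_mass P e s.

Definition joint_dens (z : bool) (w : Env R) : R := trans z w * dens w.

Lemma inv_mass_ge1 : 1 <= inv_mass P e s.
Proof.
have -> : 1 = \int[P]_w (cst 1 w : R) by rewrite Rintegral_prob_cst.
apply: le_Rintegral => //; [exact: finite_measure_integrable_cst|exact: integrable_inv_dens|].
by move=> w _; have := inv_dens_ge e w s_itv; have := back_itv e w s_itv; rewrite /cst; lra.
Qed.

Lemma trans_itv z w : 0 <= trans z w <= 1.
Proof. by rewrite /trans; have := back_itv e w s_itv; case: ifP; lra. Qed.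

Lemma dens_itv w : 0 <= dens w <= 2.
Proof.
have hI := inv_dens_itv e w s_itv; have m1 := inv_mass_ge1.
by rewrite /dens divr_ge0/= ?ler_pdivrMr; nra.
Qed.

Lemma joint_dens_ge0 z w : 0 <= joint_dens z w.
Proof. by have := trans_itv z w; have := dens_itv w; rewrite /joint_dens; nra. Qed.

Lemma joint_dens_sum w : joint_dens true w + joint_dens false w = dens w.
Proof. by rewrite /joint_dens /trans; case: e => /=; ring. Qed.

(** Mass arriving at the origin from its two neighbours. Up to normalisation, the flux equations on
    the two adjacent bonds turn it into (1 + b h) + ((1 - b) h - 1) = h. *)
Lemma joint_dens_flow w :
  joint_dens true (shift (- zint true) w) +
  joint_dens false (shift (- zint false) w) = dens w.
Proof.
(* Written with [e] and [~~ e], the identity is proved for both directions at once. *)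
have flow : joint_dens e (shift (- zint e) w) +
    joint_dens (~~ e) (shift (- zint (~~ e)) w) = dens w.
  have h1 := inv_densE e w s_itv; have h2 := inv_densE e (shift (- zint e) w) s_itv.
  rewrite shiftK in h2.
  have eN : (~~ e == e) = false by case: e.
  rewrite /joint_dens /trans /dens eqxx zintN opprK eN.
  by rewrite !mulrA -mulrDl h2; congr (_ / _); lra.
by rewrite -[RHS]flow; case: e; rewrite // addrC.
Qed.

Lemma measurable_trans z : measurable_fun setT (trans z).
Proof.
have mb := measurable_back e s_itv.
by rewrite /trans; case: (z == e) => //; exact: measurable_funB.
Qed.

Lemma measurable_dens : measurable_fun setT dens.
Proof. by apply: measurable_funM => //; exact: measurable_inv_dens. Qed.

Lemma measurable_joint_dens z : measurable_fun setT (joint_dens z).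
Proof. by apply: measurable_funM; [exact: measurable_trans|exact: measurable_dens]. Qed.

Lemma integrable_joint_dens z : P.-integrable setT (EFin \o joint_dens z).
Proof.
apply: (@bounded_integrable _ _ _ _ _ 2); first exact: measurable_joint_dens.
move=> w; rewrite ger0_norm ?joint_dens_ge0//.
by have := trans_itv z w; have := dens_itv w; rewrite /joint_dens; nra.
Qed.

Lemma dens_mass : \int[P]_w dens w = 1.
Proof.
have m1 := inv_mass_ge1.
rewrite /dens RintegralZr//; last exact: integrable_inv_dens.
by rewrite -/(inv_mass P e s) divff// gt_eqF//; lra.
Qed.

Lemma joint_dens_mass :
  \int[P]_w joint_dens true w + \int[P]_w joint_dens false w = 1.
Proof.
rewrite -RintegralD//; [|exact: integrable_joint_dens|exact: integrable_joint_dens].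
by under eq_Rintegral do rewrite joint_dens_sum; exact: dens_mass.
Qed.

Lemma integrable_back_inv_dens :
  P.-integrable setT (EFin \o (fun w => back e s w * inv_dens e s w)).
Proof.
apply: (@bounded_integrable _ _ _ _ _ 2).
  by apply: measurable_funM; [exact: measurable_back|exact: measurable_inv_dens].
move=> w; have := back_itv e w s_itv; have := inv_dens_itv e w s_itv.
by rewrite ler_norml; nra.
Qed.

(** With m = [inv_mass P e s], the steps along and against [e] have probabilities (m + 1) / (2 m)
    and (m - 1) / (2 m), which differ by 1 / m. *)
Lemma joint_dens_drift :
  \int[P]_w joint_dens true w - \int[P]_w joint_dens false w =
  zval R e / inv_mass P e s.
Proof.
have m1 := inv_mass_ge1; have ibh := integrable_back_inv_dens.
have ih := integrable_inv_dens P e s_itv.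
have ibh1 : P.-integrable setT (EFin \o (fun w => back e s (shift (zint e) w) *
    inv_dens e s (shift (zint e) w))).
  exact: (stationary_integrable Pstat (zint e) ibh).
(* The integrated flux equation reads m - E[b h] = 1 + E[b h], since stationarity removes the
   shift. *)
have bh : \int[P]_w (back e s w * inv_dens e s w) = (inv_mass P e s - 1) / 2.
  have : \int[P]_w (inv_dens e s w - back e s w * inv_dens e s w) =
         \int[P]_w (cst 1 w + back e s (shift (zint e) w) *
                         inv_dens e s (shift (zint e) w)).
    by apply: eq_Rintegral => w _; rewrite /cst -inv_densE//; ring.
  rewrite RintegralB// RintegralD//; last exact: finite_measure_integrable_cst.
  rewrite Rintegral_prob_cst.
  rewrite (stationary_Rintegral Pstat (zint e) (f := fun w => back e s w * inv_dens e s w))//.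
  by rewrite -/(inv_mass P e s); set x := Rintegral _ _ _; lra.
have jE z : \int[P]_w joint_dens z w =
   (if z == e then (inv_mass P e s + 1) / 2 else (inv_mass P e s - 1) / 2) / inv_mass P e s.
  transitivity (\int[P]_w ((if z == e then inv_dens e s w - back e s w * inv_dens e s w
     else back e s w * inv_dens e s w) / inv_mass P e s)).
    apply: eq_Rintegral => w _; rewrite /joint_dens /trans /dens.
    by case: ifP => _; ring.
  case: ifP => _; rewrite RintegralZr ?bh//.
    by rewrite RintegralB// bh -/(inv_mass P e s); field; lra.
  exact: (integrableB measurableT ih ibh).
have m0 : inv_mass P e s != 0 by rewrite gt_eqF//; lra.
rewrite !jE; move: (inv_mass P e s) m0 => m m0.
by rewrite /zval; case: (e) => /=; field.
Qed.

End InvariantMeasure.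

(** * The measure on environments and steps *)

Section JointMeasure.
Context {R : realType} (P : probability (Env R) R) (Pstat : stationary P).
Variables (e : bool) (s : R).
Hypothesis s_itv : 0 <= s <= 4^-1.

Local Notation g := (joint_dens P e s).
Local Notation dens := (dens P e s).

Lemma exists_joint_measure : exists mu : probability (Env R * bool)%type R,
  forall D (f : Env R * bool -> \bar R), measurable D -> measurable_fun setT f ->
    (forall x, 0 <= f x)%E ->
    (\int[mu]_(x in D) f x =
     \int[P]_(x in [set x | D (x, true)]) (f (x, true) * (g true x)%:E) +
     \int[P]_(x in [set x | D (x, false)]) (f (x, false) * (g false x)%:E))%E.
Proof.
apply: density_prod_bool => //.
- by move=> z w; exact: joint_dens_ge0.
- by move=> z; exact: integrable_joint_dens.
have fin z := integrable_fin_num measurableT (integrable_joint_dens P e s_itv z).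
have := joint_dens_mass P e s_itv.
rewrite /Rintegral -(fineD (fin true) (fin false)) => mass1.
rewrite -(fineK (x := (_ + _)%E)); last by rewrite fin_numD; apply/andP; split; exact: fin.
by congr EFin.
Qed.

Variable mu : probability (Env R * bool)%type R.
Hypothesis muE : forall D (f : Env R * bool -> \bar R),
  measurable D -> measurable_fun setT f -> (forall x, 0 <= f x)%E ->
  (\int[mu]_(x in D) f x =
   \int[P]_(x in [set x | D (x, true)]) (f (x, true) * (g true x)%:E) +
   \int[P]_(x in [set x | D (x, false)]) (f (x, false) * (g false x)%:E))%E.

Lemma joint_measureE D : measurable D ->
  (mu D = \int[P]_(x in [set x | D (x, true)]) (g true x)%:E +
          \int[P]_(x in [set x | D (x, false)]) (g false x)%:E)%E.
Proof.
move=> mD; have := muE mD (measurable_cst (1%E : \bar R)) (fun=> lee01).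
rewrite integral_cst// mul1e => ->.
by congr (_ + _)%E; apply: eq_integral => x _; exact: mul1e.
Qed.

Lemma joint_measure_rect (A : set (Env R)) z : measurable A ->
  mu (A `*` [set z]) = (\int[P]_(x in A) (g z x)%:E)%E.
Proof.
move=> mA; rewrite joint_measureE; last exact: measurableX.
have secE b : [set x | (A `*` [set z]) (x, b)] = if b == z then A else set0.
  by case: eqP => [->|bz]; apply/seteqP; split => x //= [].
by rewrite !secE {secE}; case: z => /=; rewrite integral_set0 ?adde0 ?add0e.
Qed.

Lemma int_marg1E (A : set (Env R)) (h : Env R -> R) : measurable A ->
  measurable_fun setT h -> (forall w, 0 <= h w) ->
  int_marg1 mu A h = (\int[P]_(w in A) (h w * dens w)%:E)%E.
Proof.
move=> mA mh h0; rewrite /int_marg1 muE; last 3 first.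
- exact: measurableX.
- by apply/measurable_EFinP; apply: measurableT_comp => //; exact: measurable_fst.
- by move=> p; rewrite lee_fin.
have secE b : [set x | (A `*` [set: bool]) (x, b)] = A.
  by apply/seteqP; split => x //= [].
rewrite !secE -ge0_integralD//=.
- by apply: eq_integral => w _; rewrite -EFinD -mulrDr joint_dens_sum.
- by move=> w _; rewrite lee_fin mulr_ge0// joint_dens_ge0.
- apply/measurable_EFinP; apply: measurable_funTS; apply: measurable_funM => //.
  exact: measurable_joint_dens.
- by move=> w _; rewrite lee_fin mulr_ge0// joint_dens_ge0.
- apply/measurable_EFinP; apply: measurable_funTS; apply: measurable_funM => //.
  exact: measurable_joint_dens.
Qed.

Lemma marg1E (A : set (Env R)) : measurable A ->
  marg1 mu A = (\int[P]_(w in A) (dens w)%:E)%E.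
Proof.
move=> mA; have -> : marg1 mu A = int_marg1 mu A (cst 1).
  by rewrite /marg1 -[LHS]mul1e -integral_cst//; exact: measurableX.
rewrite int_marg1E//.
by apply: eq_integral => w _; rewrite mul1r.
Qed.

Lemma marg1_null (A : set (Env R)) : measurable A -> P A = 0%E -> marg1 mu A = 0%E.
Proof.
move=> mA PA; rewrite marg1E//; apply: null_set_integral => //.
by apply/measurable_EFinP; apply: measurable_funTS; exact: measurable_dens.
Qed.

Lemma measurable_step :
  measurable_fun setT (fun p : Env R * bool => shift (zint p.2) p.1).
Proof.
have -> : (fun p : Env R * bool => shift (zint p.2) p.1) =
  (fun p => if p.2 then shift (zint true) p.1 else shift (zint false) p.1).
  by apply/funext => -[w []].
have mz z : measurable_fun setT (fun p : Env R * bool => shift (zint z) p.1).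
  by apply: measurableT_comp; [exact: measurable_shift|exact: measurable_fst].
apply: measurable_fun_ifT => //; exact: measurable_snd.
Qed.

(** Stationarity translates the part carried by the step [z] by [- zint z]; the translated densities
    add up to [dens] by [joint_dens_flow]. *)
Lemma marg2E (A : set (Env R)) : measurable A -> marg2 mu A = marg1 mu A.
Proof.
move=> mA; rewrite marg1E// /marg2 joint_measureE; last first.
  by rewrite -[X in measurable X]setTI; exact: measurable_step.
have partE z : (\int[P]_(x in [set x | A (shift (zint z) x)]) (g z x)%:E =
    \int[P]_(x in A) (g z (shift (- zint z) x))%:E)%E.
  rewrite integral_mkcond [RHS]integral_mkcond.
  rewrite -[RHS](stationary_ge0_integral Pstat (zint z)); last 2 first.
  - apply/(measurable_restrictT _ mA)/measurable_EFinP; apply: measurable_funTS.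
    by apply: measurableT_comp; [exact: measurable_joint_dens|exact: measurable_shift].
  - by move=> w; rewrite /patch; case: ifP => // _; rewrite lee_fin joint_dens_ge0.
  apply: eq_integral => w _; rewrite /patch shiftNK.
  by congr (if _ then _ else _); apply/idP/idP; rewrite !inE.
rewrite !partE -ge0_integralD//=.
- by apply: eq_integral => w _; rewrite -EFinD joint_dens_flow.
- by move=> w _; rewrite lee_fin joint_dens_ge0.
- apply/measurable_EFinP; apply: measurable_funTS.
  by apply: measurableT_comp; [exact: measurable_joint_dens|exact: measurable_shift].
- by move=> w _; rewrite lee_fin joint_dens_ge0.
- apply/measurable_EFinP; apply: measurable_funTS.
  by apply: measurableT_comp; [exact: measurable_joint_dens|exact: measurable_shift].
Qed.

(** As [dens] is the density of the first marginal, [trans] is the conditional law of the step. *)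
Lemma joint_measure_trans (A : set (Env R)) z : measurable A ->
  mu (A `*` [set z]) = int_marg1 mu A (trans e s z).
Proof.
move=> mA; rewrite joint_measure_rect// int_marg1E//; first exact: measurable_trans.
by move=> w; have := trans_itv e s_itv z w; lra.
Qed.

(** The first marginal is dominated by [P], so an identity that holds [P]-a.s. may be used under
    [mu]. *)
Lemma int_marg1_ae (A : set (Env R)) (h k : Env R -> R) : measurable A ->
  measurable_fun setT h -> measurable_fun setT k -> {ae P, forall w, h w = k w} ->
  int_marg1 mu A h = int_marg1 mu A k.
Proof.
move=> mA mh mk [N [mN PN hk]]; apply: ae_eq_integral.
- exact: measurableX.
- apply: measurable_funTS; apply/measurable_EFinP.
  by apply: measurableT_comp => //; exact: measurable_fst.
- apply: measurable_funTS; apply/measurable_EFinP.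
  by apply: measurableT_comp => //; exact: measurable_fst.
exists (N `*` setT); split; first exact: measurableX.
  exact: marg1_null.
move=> p /= np; split => //; apply: hk => hkp; apply: np => _.
by rewrite hkp.
Qed.

Lemma joint_measure_drift : A_xi (zval R e / inv_mass P e s) mu.
Proof.
have mz : measurable_fun setT (fun p : Env R * bool => zval R p.2).
  exact: (measurableT_comp (f := zval R) _ measurable_snd).
have iz : mu.-integrable setT (EFin \o (fun p => zval R p.2)).
  apply: (@bounded_integrable _ _ _ _ _ 1) => // -[w b].
  by rewrite /zval/=; case: b; rewrite ?normrN normr1.
have i1 : mu.-integrable setT (EFin \o cst 1).
  exact: finite_measure_integrable_cst.
(* [muE] covers nonnegative integrands only, hence z + 1, which is 2 on steps +1 and 0 on steps
   -1. *)
have h : (\int[mu]_p (zval R p.2 + 1)%:E = (2 * \int[P]_w joint_dens P e s true w)%:E)%E.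
  rewrite muE//; last 2 first.
  - by apply/measurable_EFinP; exact: measurable_funD.
  - by move=> [w []]; rewrite lee_fin /zval/=; lra.
  rewrite [X in (_ + X)%E](_ : _ = 0%E); last first.
    by apply: integral0_eq => w _; rewrite /zval/= addNr mul0e.
  rewrite adde0 /= (_ : [set x : Env R | [set: Env R * bool] (x, true)] = setT)//.
  have ij := integrable_joint_dens P e s_itv true.
  rewrite EFinM fineK; last exact: (integrable_fin_num measurableT ij).
  rewrite -ge0_integralZl//.
  - by apply/measurable_EFinP; exact: measurable_joint_dens.
  - by move=> w _; rewrite lee_fin joint_dens_ge0.
have : (\int[mu]_p (zval R p.2 + 1)%:E = \int[mu]_p (zval R p.2)%:E + 1)%E.
  rewrite (integralD_EFin measurableT iz i1); congr (_ + _)%E.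
  transitivity (\int[mu]_p cst 1%E p)%E => //.
  by rewrite integral_cst// mul1e; exact: (@probability_setT _ _ _ mu).
rewrite h /A_xi -(joint_dens_drift Pstat e s_itv).
have zfin : (\int[mu]_p (zval R p.2)%:E)%E \is a fin_num.
  exact: (integrable_fin_num measurableT iz).
(* Total mass 1 turns twice the mass of the steps +1, minus 1, into the difference of the two
   masses. *)
have := joint_dens_mass P e s_itv.
rewrite -(fineK zfin) -EFinD; move: (fine _) => y mass1 hy.
have {}hy := congr1 fine hy; rewrite /= in hy.
congr EFin; lra.
Qed.

Lemma joint_measure_M1s_ll : 0 < s -> {ae P, forall w, 0 < jump e w < 1} ->
  M1s_ll P mu.
Proof.
move=> s0 jump01; split; first by move=> A mA; rewrite marg2E.
  exact: marg1_null.
move=> z; exists (trans e s z); split.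
- exact: measurable_trans.
- by move=> w; have := trans_itv e s_itv z w; lra.
- by move=> A mA; exact: joint_measure_trans.
- have sI : 0 < s <= 4^-1 by case/andP: s_itv => _ ->; rewrite s0.
  (* Positivity of the step against [e] comes from [back_gt0]; the step [e] has probability at least
     3/4. *)
  move: (back_gt0 Pstat jump01 sI); apply: filterS => w b0.
  by rewrite /trans; have := back_itv e w s_itv; case: ifP => _; lra.
Qed.

End JointMeasure.

(** * Power inequalities and discrete primitives *)

Lemma powR_le_sum {R : realType} (a p x y : R) : 0 <= p -> 0 <= x -> 0 <= y ->
  a <= x + y -> 0 <= a -> a `^ p <= 2 `^ p * x `^ p + 2 `^ p * y `^ p.
Proof.
move=> p0 x0 y0 axy a0; rewrite -!powRM//.
(* The sum x + y is at most twice the larger term. *)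
have [xy|yx] := leP x y.
  apply: (@le_trans _ _ ((2 * y) `^ p)); last by rewrite lerDr powR_ge0.
  by apply: ge0_ler_powR; rewrite ?nnegrE//; lra.
apply: (@le_trans _ _ ((2 * x) `^ p)); last by rewrite lerDl powR_ge0.
by apply: ge0_ler_powR; rewrite ?nnegrE//; lra.
Qed.

Lemma le_powR1D {R : realType} (alpha x : R) : 0 < alpha -> 0 <= x ->
  x <= 1 + x `^ (1 + alpha).
Proof.
move=> a0 x0; have [x1|x1] := leP x 1.
  by rewrite (le_trans x1)// lerDl powR_ge0.
rewrite (@le_trans _ _ (x `^ (1 + alpha)))//; last by rewrite lerDr.
rewrite -[leLHS]powRr1//; apply: ler_powR; lra.
Qed.

(** Discrete primitive of [c] on the integers, vanishing at 0. [Negz n] is -(n + 1), so the negative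
    branch sums [c] over -1, ..., -(n + 1). *)
Definition antidiff {R : realType} (c : int -> R) (x : int) : R :=
  match x with
  | Posz n => \sum_(i < n) c i%:Z
  | Negz n => - \sum_(i < n.+1) c (- i.+1%:Z)
  end.

Lemma antidiffS {R : realType} (c : int -> R) (x : int) :
  antidiff c (x + 1) - antidiff c x = c x.
Proof.
case: x => [n|[|n]].
- have -> : n%:Z + 1 = n.+1%:Z by lia.
  by rewrite /= big_ord_recr/= addrAC subrr add0r.
- have -> : Negz 0 + 1 = 0 by [].
  by rewrite /= big_ord0 sub0r opprK big_ord_recr big_ord0/= add0r NegzE.
- have -> : Negz n.+1 + 1 = Negz n by lia.
  by rewrite /= [in X in _ - X]big_ord_recr/= NegzE; ring.
Qed.

(** * The gradient field of the tilting function *)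

Section LogRatio.
Context {R : realType} (P : probability (Env R) R) (Pstat : stationary P).
Variables (e : bool) (s : R).
Hypothesis s_itv : 0 < s <= 4^-1.
Variable alpha : R.
Hypothesis alpha0 : 0 < alpha.
Hypothesis jump_log :
  (\int[P]_w ((`|ln (jump e w)| `^ (1 + alpha))%:E) < +oo)%E.

Let s_itv' : 0 <= s <= 4^-1. Proof. by case/andP: s_itv => /ltW -> ->. Qed.

(** Where p = [jump e w] is positive, this is the L with s p e^L = 1 - b, the tilted probability of
    a step [e]. *)
Definition log_ratio (w : Env R) : R :=
  - ln s - ln (jump e w) + ln (1 - back e s w).

Definition mean_log_ratio : R := \int[P]_w log_ratio w.

(** The second branch is minus the first one taken one site behind, so crossing a bond backwards
    flips the sign; subtracting the mean centres both branches. *)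
Definition corrector (p : Env R * bool) : R :=
  if p.2 == e then log_ratio p.1 - mean_log_ratio
  else mean_log_ratio - log_ratio (shift (- zint e) p.1).

Lemma measurable_ln_jump : measurable_fun setT (fun w : Env R => ln (jump e w)).
Proof. exact: measurableT_comp (@measurable_ln R) (measurable_jump e). Qed.

Lemma measurable_log_ratio : measurable_fun setT log_ratio.
Proof.
apply: measurable_funD; first by apply: measurable_funB => //; exact: measurable_ln_jump.
apply: (measurableT_comp (@measurable_ln R)).
by apply: measurable_funB => //; exact: measurable_back.
Qed.

(** 1 - [back] lies in [3/4, 1], so only the logarithm of [jump] can be unbounded. *)
Lemma log_ratio_bound : exists2 C, 0 <= C &
  forall w, `|log_ratio w| <= C + `|ln (jump e w)|.
Proof.
exists (`|ln s| + `|ln (3 / 4)|); first by rewrite addr_ge0.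
move=> w; rewrite /log_ratio.
have bI := back_itv e w s_itv'.
have lnb : `|ln (1 - back e s w)| <= `|ln (3 / 4 : R)|.
  rewrite !ler0_norm ?ln_le0//; [|lra|lra].
  by rewrite lerN2 ler_ln// ?posrE; lra.
rewrite (le_trans (ler_normD _ _))//.
rewrite (le_trans (lerD (ler_normB _ _) lnb))// normrN; lra.
Qed.

Lemma integrable_powR_ln_jump :
  P.-integrable setT (fun w => (`|ln (jump e w)| `^ (1 + alpha))%:E).
Proof.
apply/integrableP; split.
  apply/measurable_EFinP; apply: (measurableT_comp (@measurable_powR R (1 + alpha))).
  by apply: measurableT_comp => //; exact: measurable_ln_jump.
by under eq_integral do rewrite /= ger0_norm ?powR_ge0//.
Qed.

Lemma integrable_log_ratio : P.-integrable setT (EFin \o log_ratio).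
Proof.
have [C C0 LC] := log_ratio_bound.
apply: (@le_integrable _ _ _ _ _ measurableT _
   (fun w => (C + 1)%:E + (`|ln (jump e w)| `^ (1 + alpha))%:E)%E).
- by apply/measurable_EFinP; exact: measurable_log_ratio.
- move=> w _; rewrite /= lee_fin (le_trans (LC w))// [leRHS]ger0_norm.
    by rewrite -addrA lerD2l le_powR1D.
  by rewrite addr_ge0 ?powR_ge0// addr_ge0.
apply: integrableD => //; first exact: finite_measure_integrable_cst.
exact: integrable_powR_ln_jump.
Qed.

Lemma log_ratio_moment (c : R) :
  (\int[P]_w ((`|log_ratio w - c| `^ (1 + alpha))%:E) < +oo)%E.
Proof.
have [C C0 LC] := log_ratio_bound.
have p0 : 0 <= 1 + alpha by rewrite addr_ge0// ltW.
have Cc : 0 <= C + `|c| by rewrite addr_ge0.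
pose K := 2 `^ (1 + alpha).
pose G w := ((K * (C + `|c|) `^ (1 + alpha))%:E +
   K%:E * (`|ln (jump e w)| `^ (1 + alpha))%:E)%E.
have iG : P.-integrable setT G.
  apply: integrableD => //; first exact: finite_measure_integrable_cst.
  exact: (integrableZl measurableT K integrable_powR_ln_jump).
apply: (@le_lt_trans _ _ (\int[P]_w G w)%E); last first.
  by rewrite ltey_eq (integrable_fin_num measurableT iG).
apply: ge0_le_integral => //.
- apply/measurable_EFinP; apply: (measurableT_comp (@measurable_powR R (1 + alpha))).
  apply: measurableT_comp => //; apply: measurable_funB => //.
  exact: measurable_log_ratio.
- exact: measurable_int iG.
move=> w _; rewrite /G -EFinM -EFinD lee_fin; apply: powR_le_sum => //.
by rewrite (le_trans (ler_normB _ _))//; have := LC w; lra.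
Qed.

Lemma corrector_potential w x :
  corrector (shift x w, true) = - corrector (shift (x + 1) w, false).
Proof.
rewrite /corrector; case: (e) => /=; rewrite ?opprB; congr (_ - _);
  congr log_ratio; rewrite shift_shift; congr (shift _ w); lia.
Qed.

Lemma corrector_in_K : in_K P corrector.
Proof.
have mL := measurable_log_ratio; have iL := integrable_log_ratio.
have mc z : measurable_fun setT (fun w : Env R => corrector (w, z)).
  rewrite /corrector/=; case: (z == e); first exact: measurable_funB.
  by apply: measurable_funB => //; apply: measurableT_comp => //; exact: measurable_shift.
split.
- have -> : corrector = (fun p => if p.2 then corrector (p.1, true) else corrector (p.1, false)).
    by apply/funext => -[w []].
  apply: measurable_fun_ifT; first exact: measurable_snd.
    exact: (measurableT_comp (mc true) measurable_fst).
  exact: (measurableT_comp (mc false) measurable_fst).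
- exists alpha; split => // z; rewrite /corrector/=; case: (z == e).
    exact: log_ratio_moment.
  (* Stationarity removes the shift in the second branch. *)
  rewrite (stationary_ge0_integral Pstat (- zint e)
    (f := fun w => (`|mean_log_ratio - log_ratio w| `^ (1 + alpha))%:E))//.
  + by under eq_integral do rewrite distrC; exact: log_ratio_moment.
  + apply/measurable_EFinP; apply: (measurableT_comp (@measurable_powR R (1 + alpha))).
    by apply: measurableT_comp => //; exact: measurable_funB.
- have ic : P.-integrable setT (EFin \o cst mean_log_ratio).
    exact: finite_measure_integrable_cst.
  have cE : (\int[P]_w (cst mean_log_ratio w)%:E = mean_log_ratio%:E)%E.
    have := Rintegral_prob_cst P mean_log_ratio; rewrite /Rintegral => h.
    by rewrite -[LHS]fineK ?h// (integrable_fin_num measurableT ic).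
  have LE : (\int[P]_w (log_ratio w)%:E = mean_log_ratio%:E)%E.
    by rewrite /mean_log_ratio /Rintegral fineK// (integrable_fin_num measurableT iL).
  move=> z; rewrite /corrector/=; case: (z == e).
    by rewrite (integralB_EFin measurableT iL ic) cE LE subee.
  rewrite (stationary_integral Pstat (- zint e)
    (f := fun w => (mean_log_ratio - log_ratio w)%:E)).
    by rewrite (integralB_EFin measurableT ic iL) cE LE subee.
  exact: (integrableB measurableT ic iL).
(* The loop condition holds for every environment. *)
- apply: aeW => w n x x0n xstep.
  (* [U] is a potential on the line: each step of the path contributes an increment of [U], so the
     sum over a closed path telescopes to 0. *)
  pose U := antidiff (fun y => corrector (shift y w, true)).
  transitivity (\sum_(k < n) (U (x k.+1) - U (x k))).
    apply: eq_bigr => k _; have [xk|xk] := xstep k (ltn_ord k); rewrite xk.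
      have -> : x k.+1 = x k + 1 by rewrite -xk addrC subrK.
      by rewrite /U antidiffS eqxx.
    (* A step to the left is the reverse of the step to the right from [x k.+1]. *)
    have -> : x k = x k.+1 + 1 by rewrite -[x k](subrK (x k.+1)) addrC -opprB xk opprK.
    rewrite -opprB /U antidiffS corrector_potential opprK.
    by congr corrector.
  by rewrite -(big_mkord xpredT (fun k => U (x k.+1) - U (x k))) telescope_sumr// x0n subrr.
Qed.

End LogRatio.

(** * The tilted kernel in exponential form *)

Section DensityForm.
Context {R : realType}.

Lemma jump_pi0 (e : bool) (w : Env R) : 0 <= w 0 <= 1 -> jump e w = pi0 w e.
Proof. by move=> w01; rewrite /jump clamp01_id. Qed.

Lemma measurable_pi0 (z : bool) : measurable_fun setT (fun w : Env R => pi0 w z).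
Proof.
by case: z; rewrite /pi0; [|apply: measurable_funB => //]; exact: measurable_coord.
Qed.

Lemma pi0N (e : bool) (w : Env R) : pi0 w (~~ e) = 1 - pi0 w e.
Proof. by rewrite /pi0; case: e => //=; rewrite subKr. Qed.

Lemma zvalN (e : bool) : zval R (~~ e) = - zval R e.
Proof. by case: e; rewrite /zval/= ?opprK. Qed.

Lemma zval_sq (e : bool) : zval R e * zval R e = 1.
Proof. by case: e; rewrite /zval ?mulrNN mulr1. Qed.

Variables (P : probability (Env R) R) (e : bool) (s : R).
Hypothesis s_itv : 0 < s <= 4^-1.
Variable w : Env R.
Hypothesis w01 : 0 <= w 0 <= 1.
Hypothesis jump01 : 0 < jump e w < 1.
Hypothesis jump01' : 0 < jump e (shift (- zint e) w) < 1.

(** The term theta z cancels the centring of the corrector. A step [e] then has weight s p e^L = 1 -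
    b, and a step against [e] has weight s (1 - p) e^{-L o T_{-e}}, which is the right-hand side of
    the equation for b. *)
Lemma transE z :
  pi0 w z * expR (zval R e * mean_log_ratio P e s * zval R z +
                  corrector P e s (w, z) + ln s) = trans e s z w.
Proof.
have [s0 s1] : 0 < s /\ s <= 4^-1 by apply/andP.
have sI : 0 <= s <= 4^-1 by rewrite ltW.
have bI := back_itv e w sI; have bI' := back_itv e (shift (- zint e) w) sI.
have j01 := jump01.
have lnK' (x : R) : 0 < x -> expR (ln x) = x by move=> x0; rewrite lnK ?posrE.
rewrite /corrector /trans/=; have [->|ze] := eqVneq z e.
  rewrite mulrAC zval_sq mul1r -jump_pi0// addrCA subrr addr0 /log_ratio.
  rewrite (_ : _ + ln s = ln (1 - back e s w) - ln (jump e w)); last by ring.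
  rewrite expRD expRN (lnK' (1 - _)); last lra.
  rewrite lnK'; last lra.
  by rewrite mulrCA divff ?mulr1// gt_eqF//; lra.
have -> : z = ~~ e by case: (z) ze; case: (e).
rewrite zvalN mulrN mulrAC zval_sq mul1r addKr pi0N -jump_pi0// backE// /cond.
move: bI' jump01'; rewrite /log_ratio.
move: (back _ _ _) (jump e (shift _ w)) => b' j' bI' j1I.
rewrite (_ : _ + ln s = ln s + ln s + ln j' - ln (1 - b')); last by ring.
rewrite expRD expRN (lnK' (1 - _)); last lra.
rewrite !expRD (lnK' s)// (lnK' j'); last lra.
by field; lra.
Qed.

End DensityForm.

(** * Tilted measures of prescribed speed, and both directions together *)

Lemma exists_tilted_measure {R : realType} (P : probability (Env R) R)
    (Pstat : stationary P) (e : bool) (alpha v : R) :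
  0 < alpha ->
  {ae P, forall w : Env R, 0 <= w 0 <= 1} ->
  {ae P, forall w : Env R, 0 < jump e w < 1} ->
  (\int[P]_w ((`|ln (jump e w)| `^ (1 + alpha))%:E) < +oo)%E ->
  1 < v < inv_mass P e 4^-1 ->
  exists mu : probability (Env R * bool)%type R,
    [/\ A_xi (zval R e / v) mu, M1s_ll P mu &
        exists (theta : R) (F : Env R * bool -> R) (r : R),
          in_K P F /\ density_form mu theta F r].
Proof.
move=> alpha0 w01 jump01 jump_log vI.
(* The parameter [s] is chosen so that the mean of the unit-flux density is [v], that is, the speed
   is 1 / [v]. *)
have [s sI <-] := inv_mass_onto vI.
have [s0 s1] : 0 < s /\ s <= 4^-1 by apply/andP.
have sI' : 0 <= s <= 4^-1 by rewrite ltW.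
have [mu muE] := exists_joint_measure P e sI'.
exists mu; split.
- exact: (joint_measure_drift Pstat sI' muE).
- exact: (joint_measure_M1s_ll Pstat sI' muE s0 jump01).
exists (zval R e * mean_log_ratio P e s), (corrector P e s), (ln s); split.
  exact: corrector_in_K jump_log.
move=> z A mA; rewrite (joint_measure_trans sI' muE)//.
apply: (int_marg1_ae sI' muE mA); first exact: measurable_trans.
  apply: measurable_funM; first exact: measurable_pi0.
  apply: (measurableT_comp (@measurable_expR R)).
  apply: measurable_funD => //; apply: measurable_funD => //.
  have [mF _ _ _] := corrector_in_K Pstat sI alpha0 jump_log.
  exact: (measurableT_comp mF (@pair2_measurable _ _ _ _ z)).
have jump01' := stationary_ae Pstat (- zint e) jump01.
have w01j : {ae P, forall w : Env R, 0 <= w 0 <= 1 /\ 0 < jump e w < 1}.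
  by apply: filterS2 w01 jump01 => w a b; split.
move: w01j jump01'; apply: filterS2 => w [w0 j] j'.
by rewrite transE.
Qed.

Theorem theorem1p7 (R : realType) (P : probability (Env R) R)
  (Henv : {ae P, forall w : Env R, forall x : int, 0 <= w x <= 1})
  (Hstat : stationary P) (Herg : ergodic P)
  (Hlog : exists alpha : R, 0 < alpha /\ forall z : bool,
      {ae P, forall w, 0 < pi0 w z} /\
      (\int[P]_w ((`|ln (pi0 w z)| `^ (1 + alpha))%:E) < +oo)%E) :
  exists xic xic' : R,
    [/\ -1 < xic', xic' <= 0, 0 <= xic & xic < 1] /\
    forall xi : R, (-1 < xi < xic' \/ xic < xi < 1) ->
      exists mu : probability (Env R * bool)%type R,
        [/\ A_xi xi mu, M1s_ll P mu &
            exists (theta : R) (F : Env R * bool -> R) (r : R),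
              in_K P F /\ density_form mu theta F r].
Proof.
have [alpha [alpha0 Hlog']] := Hlog.
have pi_gt0 : {ae P, forall w : Env R, 0 < pi0 w true /\ 0 < pi0 w false}.
  by move: (Hlog' true).1 (Hlog' false).1; apply: filterS2 => w.
have w01 : {ae P, forall w : Env R, 0 <= w 0 <= 1}.
  by move: Henv; apply: filterS => w; exact.
have jumpE e : {ae P, forall w : Env R, jump e w = pi0 w e}.
  by move: w01; apply: filterS => w; exact: jump_pi0.
have jump01 e : {ae P, forall w : Env R, 0 < jump e w < 1}.
  move: (jumpE e) pi_gt0; apply: filterS2 => w ->.
  by case: e; rewrite /pi0 => -[]; lra.
have jump_log e : (\int[P]_w ((`|ln (jump e w)| `^ (1 + alpha))%:E) < +oo)%E.
  apply: le_lt_trans (Hlog' e).2; rewrite le_eqVlt; apply/orP; left; apply/eqP.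
  have mln (k : Env R -> R) : measurable_fun setT k ->
      measurable_fun setT (fun w => (`|ln (k w)| `^ (1 + alpha))%:E).
    move=> mk; apply/measurable_EFinP.
    apply: (measurableT_comp (@measurable_powR R (1 + alpha))).
    apply: measurableT_comp => //; exact: measurableT_comp (@measurable_ln R) mk.
  apply: ae_eq_integral => //; [exact: mln _ (measurable_jump e)|exact: mln _ (measurable_pi0 e)|].
  by move: (jumpE e); apply: filterS => w -> _.
(* Only the bound 1 < [M e] and the attained range of [v] matter from here on, so [inv_mass] is
   abstracted away. *)
have [M M1 tilted] : exists2 M : bool -> R, (forall e, 1 < M e) &
    forall e v, 1 < v < M e -> exists mu : probability (Env R * bool)%type R,
      [/\ A_xi (zval R e / v) mu, M1s_ll P mu &
          exists (theta : R) (F : Env R * bool -> R) (r : R),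
            in_K P F /\ density_form mu theta F r].
  exists (fun e => inv_mass P e 4^-1) => e.
    by apply: inv_mass_gt1 => //; lra.
  by move=> v; exact: (exists_tilted_measure Hstat alpha0 w01 (jump01 e) (jump_log e)).
have Mi1 e : 0 < (M e)^-1 < 1.
  by have := M1 e => M1e; rewrite invr_gt0 invf_lt1//; lra.
(* Speeds between 1 / [M e] and 1 are attained in direction [e]; the direction -1 gives the negative
   threshold. *)
exists (M true)^-1, (- (M false)^-1); split.
  move: (Mi1 true) (Mi1 false); move: (M true)^-1 (M false)^-1 => a b aI bI.
  by split; lra.
have invI e (y : R) : (M e)^-1 < y < 1 -> 1 < y^-1 < M e.
  move=> /andP[My y1]; have /andP[MI _] := Mi1 e.
  have y0 : 0 < y by exact: lt_trans My.
  by rewrite invf_gt1// y1 -[ltRHS]invrK ltf_pV2 ?posrE.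
move=> xi [/andP[xi1 xiM]|/andP[xiM xi1]].
  (* A negative [xi] is the speed [- xi] in the direction -1. *)
  have := tilted false (- xi)^-1; rewrite /zval invrK mulN1r opprK; apply.
  by apply: invI; rewrite ltrNr xiM ltrNl.
have := tilted true xi^-1; rewrite /zval invrK mul1r; apply.
by apply: invI; rewrite xiM xi1.
Qed.
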